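(* Let $\Lambda$ be an infinite connected (multi)graph with a distinguished vertex $v_0$, and let $p,q$ be positive integers. Maker has a winning strategy for the $(p,q)$-percolation game on $(\Lambda,v_0)$ if and only if, for every finite connected induced subgraph $X$ of $\Lambda$ with $v_0\in V(X)$, Maker has a winning strategy for the $(p,q)$-escape game on $(X,\Lambda,v_0)$.
   Context: The $(p,q)$-percolation game on $(\Lambda,v_0)$: two players, Maker and Breaker, play in alternating turns, with Maker playing first. Initially all edges of $\Lambda$ are marked as unsafe. On each of her turns, Maker marks $p$ unsafe edges as safe; on each of his turns, Breaker takes $q$ unsafe edges and deletes them from the graph. Breaker wins if at any time in the game the component containing $v_0$ (in the graph of edges not deleted) becomes finite. If Maker is able to ensure that $v_0$ remains in an infinite component indefinitely, then she is said to have a winning strategy. Let $X$ be a finite connected induced subgraph of $\Lambda$ with $v_0\in V(X)$. The boundary $\partial_\Lambda(X)$ of $X$ in $\Lambda$ is the set of vertices of $X$ that send an edge of $\Lambda$ to a vertex in $V(\Lambda)\setminus V(X)$. The $(p,q)$-escape game on $(X,\Lambda,v_0)$: two players, Maker and Breaker, claim edges of the finite graph $X$ in alternating turns, with Maker playing first. On each of her turns Maker claims $p$ as-yet-unclaimed edges of $X$ for herself, and on each of his turns Breaker claims $q$ such edges for himself (a player claims all remaining edges if fewer than the prescribed number remain). Maker wins if she manages to claim all of the edges of a path from $v_0$ to a vertex of $\partial_\Lambda(X)$ (the path may have length zero, so that Maker wins automatically if $v_0\in\partial_\Lambda(X)$), while Breaker wins if he claims at least one edge from every such path.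
   Formalization: The multigraph is assumed to have only finitely many parallel edges between any two vertices (and finitely many loops at each vertex); with infinitely many parallel edges the equivalence can fail. Local finiteness is not assumed. *)

(* Defs.v *)
From mathcomp Require Import all_boot finmap.
From mathcomp Require Import classical_sets cardinality.

Set Implicit Arguments.
Unset Strict Implicit.
Unset Printing Implicit Defensive.

Local Open Scope classical_set_scope.

(* The order of the pair [ends e] is irrelevant: edges are only ever used
   through the symmetric predicate [joins].  Loops are allowed.  The edges form
   a multiset of pairs, so each pair of vertices has a finite multiplicity; in
   particular, an induced subgraph on finitely many vertices is a finite graph.
   Local finiteness is not assumed. *)
Record multigraph := Multigraph {
  vertex : choiceType;
  edge : choiceType;
  ends : edge -> vertex * vertex;
  finite_multiplicity : forall u v : vertex,
    finite_set [set e | (ends e == (u, v)) || (ends e == (v, u))]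
}.

Section Graph.
Variable L : multigraph.
Implicit Types (u v : vertex L) (e : edge L) (S : set (edge L)).

Definition joins e u v : bool := (ends e == (u, v)) || (ends e == (v, u)).

Definition infinite_graph : Prop := infinite_set [set: vertex L].

(* The list [:: (e1, v1); ...; (en, vn)] encodes the walk u e1 v1 ... en vn. *)
Fixpoint is_walk u (s : seq (edge L * vertex L)) : bool :=
  if s is (e, v) :: s' then joins e u v && is_walk v s' else true.

Definition is_path u v (s : seq (edge L * vertex L)) : bool :=
  [&& is_walk u s, uniq (u :: unzip2 s) & last u (unzip2 s) == v].

Definition path_within S u v : Prop :=
  exists s, is_path u v s /\ [set` unzip1 s] `<=` S.

Definition connected_by S (A : set (vertex L)) : Prop :=
  forall u v, A u -> A v -> path_within S u v.

Definition connected_graph : Prop := connected_by setT setT.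

Definition component S u : set (vertex L) := [set v | path_within S u v].

(* An induced subgraph is represented by its vertex set. *)
Definition induced_edges (X : {fset vertex L}) : set (edge L) :=
  [set e | ((ends e).1 \in X) && ((ends e).2 \in X)].

Definition connected_induced (X : {fset vertex L}) : Prop :=
  connected_by (induced_edges X) [set` X].

Definition boundary (X : {fset vertex L}) : set (vertex L) :=
  [set x | x \in X /\ exists e y, y \notin X /\ joins e x y].

End Graph.

Section ClaimingGame.
Variable E : choiceType.

Definition move := {fset E}.

(* Completed rounds in chronological order: (Maker's move, Breaker's reply). *)
Definition history := seq (move * move).

Definition maker_edges (h : history) : set E :=
  [set e | has (fun r => e \in r.1) h].

Definition breaker_edges (h : history) : set E :=
  [set e | has (fun r => e \in r.2) h].

Definition unclaimed (board : set E) (h : history) : set E :=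
  board `\` (maker_edges h `|` breaker_edges h).

Definition strategy := history -> move.

(* [rule k F A]: taking A is a legal move for a player of bias k when F is the
   set of available edges. *)
Definition move_rule := nat -> set E -> move -> Prop.

Definition exact_rule : move_rule := fun k F A =>
  [set` A] `<=` F /\ #|` A| = k.

Definition exhausting_rule : move_rule := fun k F A =>
  [set` A] `<=` F /\ (#|` A| = k \/ (#|` A| < k /\ F `<=` [set` A])).

Inductive consistent (rule : move_rule) (board : set E) (q : nat)
    (sigma : strategy) : history -> Prop :=
| consistent_nil : consistent rule board q sigma [::]
| consistent_rcons h B :
    consistent rule board q sigma h ->
    rule q (unclaimed board h `\` [set` sigma h]) B ->
    consistent rule board q sigma (rcons h (sigma h, B)).

Definition legal_strategy (rule : move_rule) (board : set E) (p q : nat)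
    (sigma : strategy) : Prop :=
  forall h, consistent rule board q sigma h ->
    rule p (unclaimed board h) (sigma h).

End ClaimingGame.

Section Games.
Variables (L : multigraph) (p q : nat).

(* Maker's edges are the safe ones, Breaker's the deleted ones. *)
Definition maker_wins_percolation (v0 : vertex L) : Prop :=
  exists sigma : strategy (edge L),
    legal_strategy (@exact_rule _) setT p q sigma /\
    forall h, consistent (@exact_rule _) setT q sigma h ->
      infinite_set (component (~` breaker_edges h) v0).

(* For p, q > 0 every play exhausts the finite board.  Play goes on until then
   even if a player has already won, which does not affect the outcome. *)
Definition maker_wins_escape (X : {fset vertex L}) (v0 : vertex L) : Prop :=
  exists sigma : strategy (edge L),
    legal_strategy (@exhausting_rule _) (induced_edges X) p q sigma /\
    forall h, consistent (@exhausting_rule _) (induced_edges X) q sigma h ->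
      unclaimed (induced_edges X) h = set0 ->
      exists2 x, boundary X x & path_within (maker_edges h) v0 x.

End Games.

(* Main.v *)
(** If Maker wins every escape game, call a percolation position safe for X if
    Maker can forever keep v0 joined to the boundary of X by edges that Breaker
    does not own.  Safety for a large X implies safety for a smaller one, and the
    trace on X of a good move for a larger graph is good for X.  As moves have at
    most p edges, a maximal set contained in good moves for arbitrarily large
    graphs is a single move that is good for all X simultaneously; playing such
    moves keeps the position safe for all X.  If the component of v0 were finite,
    it would miss the boundary of a finite X containing it and the ends of
    Breaker's edges.  This compactness argument needs no local finiteness.

    Conversely, Maker wins the escape game on X by simulating a percolation play:
    at the end all edges of X are claimed, so the initial segment within X of a
    path that leaves X and avoids Breaker's edges belongs to her. *)

Require Import Defs.
From mathcomp Require Import all_boot finmap.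
From mathcomp Require Import boolp classical_sets cardinality.

Set Implicit Arguments.
Unset Strict Implicit.
Unset Printing Implicit Defensive.

(** * Paths, induced subgraphs and connectivity *)

Section Walks.
Local Open Scope classical_set_scope.
Variable L : multigraph.
Implicit Types (u v w x : vertex L) (S : set (edge L)) (X Y : {fset vertex L}).
Implicit Types s : seq (edge L * vertex L).

Lemma joinsC (e : edge L) u v : joins e u v = joins e v u.
Proof. by rewrite /joins orbC. Qed.

Lemma joins_ends (e : edge L) u v :
  joins e u v -> u \in [fset (ends e).1; (ends e).2]%fset.
Proof. by case/orP => /eqP ->; rewrite !inE eqxx ?orbT. Qed.

Lemma path_within_sub (S S' : set (edge L)) u v :
  S `<=` S' -> path_within S u v -> path_within S' u v.
Proof. by move=> sub [s [ps Ss]]; exists s; split=> // e /Ss /sub. Qed.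

Lemma path_within_refl S u : path_within S u u.
Proof. by exists [::]; split=> //=; rewrite /is_path /= eqxx. Qed.

Lemma is_walk_cat u s1 s2 :
  is_walk u (s1 ++ s2) = is_walk u s1 && is_walk (last u (unzip2 s1)) s2.
Proof. by elim: s1 u => //= -[e v] s1 IH u /=; rewrite IH andbA. Qed.

(** If [u] already occurs on the path from [v], prepending [e] would repeat it; the part of that
    path starting at [u] is then used instead. *)
Lemma path_within_cons S (e : edge L) u v w :
  joins e u v -> S e -> path_within S v w -> path_within S u w.
Proof.
move=> euv Se [s [/and3P[ws us /eqP ls] Ss]].
have [uin|unin] := boolP (u \in v :: unzip2 s); last first.
  exists ((e, v) :: s); split.
    by rewrite /is_path /= euv ws; rewrite /= in us; rewrite unin us /= ls eqxx.
  by move=> f /=; rewrite inE => /predU1P[-> //|/Ss].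
move: uin; rewrite inE => /predU1P[->|/mapP[[f u'] fs /= uu']].
  by exists s; split=> //; rewrite /is_path ws us ls eqxx.
subst u'; case/splitPr: fs ws us ls Ss => s1 s2.
rewrite is_walk_cat /unzip1 /unzip2 !map_cat last_cat /= => /and3P[_ _ ws2].
rewrite cat_uniq => /andP[_ /and3P[_ _ us2]] ls2 Ss.
exists s2; split; first by rewrite /is_path ws2 us2 ls2 eqxx.
by move=> g gs; apply: Ss; rewrite /= mem_cat inE gs !orbT.
Qed.

Lemma walk_path_within S u s w :
  is_walk u s -> [set` unzip1 s] `<=` S ->
  path_within S (last u (unzip2 s)) w -> path_within S u w.
Proof.
elim: s u => //= -[e v] s IH u /= /andP[euv ws] Ss pw.
apply: (path_within_cons euv); first by apply: Ss; rewrite /= inE eqxx.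
by apply: IH => // f fs; apply: Ss; rewrite /= inE; apply/orP; right.
Qed.

Lemma path_within_trans S u v w :
  path_within S u v -> path_within S v w -> path_within S u w.
Proof.
move=> [s [/and3P[ws _ /eqP <-] Ss]]; exact: walk_path_within.
Qed.

Lemma path_within_edge S (e : edge L) u v :
  joins e u v -> S e -> path_within S u v.
Proof. move=> euv Se; exact: path_within_cons euv Se (path_within_refl _ _). Qed.

Lemma path_within_sym S u v : path_within S u v -> path_within S v u.
Proof.
move=> [s [/and3P[ws _ /eqP <-] Ss]] {v}.
elim: s u ws Ss => [|[e v] s IH] u /=; first by move=> *; exact: path_within_refl.
move=> /andP[euv ws] Ss; apply: (@path_within_trans _ _ v).
  by apply: IH => // f fs; apply: Ss; rewrite /= inE; apply/orP; right.
apply: (@path_within_edge _ e); first by rewrite joinsC.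
by apply: Ss; rewrite /= inE eqxx.
Qed.

Lemma induced_edges_joins X (e : edge L) u v :
  joins e u v -> u \in X -> v \in X -> induced_edges X e.
Proof. by rewrite /induced_edges /= => /orP[] /eqP -> /= -> ->. Qed.

Lemma induced_edges_sub X Y : {subset X <= Y} ->
  induced_edges X `<=` induced_edges Y.
Proof. by move=> XY e /andP[e1 e2]; apply/andP; split; exact: XY. Qed.

(** Follow the path from [u] until the next vertex lies outside [X]; the vertex reached is then on
    the boundary. If this never happens, the path stays in [X] and its end [x] must be the boundary
    vertex. *)
Lemma exit_path X S u x :
  u \in X -> path_within S u x -> boundary X x \/ x \notin X ->
  exists2 x', boundary X x' & path_within (induced_edges X `&` S) u x'.
Proof.
move=> + [s [/and3P[ws _ /eqP <-] Ss]] {x}.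
elim: s u ws Ss => [|[e v] s IH] u /= => [_ _ uX|/andP[euv ws] Ss uX].
  by case=> [bu|/negP//]; exists u => //; exact: path_within_refl.
have [vX|vX] := boolP (v \in X); last first.
  move=> _; exists u; last exact: path_within_refl.
  by split=> //; exists e, v.
have Ss' : [set` unzip1 s] `<=` S.
  by move=> f fs; apply: Ss; rewrite /= inE; apply/orP; right.
case/(IH v ws Ss' vX) => x' bx' vx'; exists x' => //.
apply: (path_within_cons euv _ vx'); split; last first.
  by apply: Ss; rewrite /= inE eqxx.
exact: induced_edges_joins euv uX vX.
Qed.

Lemma finite_induced_edges X : finite_set (induced_edges X).
Proof.
apply: (@sub_finite_set _ _ (\bigcup_(uv in [set` X] `*` [set` X])
    [set e | (ends e == (uv.1, uv.2)) || (ends e == (uv.2, uv.1))])).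
  move=> e /andP[e1 e2]; exists (ends e) => //=.
  by rewrite -surjective_pairing eqxx.
apply: bigcup_finite => [|uv _]; last exact: finite_multiplicity.
by apply: finite_setX; exact: finite_fset.
Qed.

(** By connectivity every vertex other than a fixed [v0] is an end of some edge, so finitely many
    edges would leave finitely many vertices. *)
Lemma infinite_edges : infinite_graph L -> connected_graph L ->
  infinite_set [set: edge L].
Proof.
move=> Linf Lconn Efin; apply: Linf.
have [[v0 _]|L0] := pselect (exists v : vertex L, True); last first.
  suff -> : [set: vertex L] = set0 by exact: finite_set0.
  by rewrite -subset0 => v _; apply: L0; exists v.
apply: (@sub_finite_set _ _ (v0 |` \bigcup_(e in [set: edge L])
    [set` [fset (ends e).1; (ends e).2]%fset])).
  move=> v _; have [s [/and3P[ws _ /eqP ls] _]] := Lconn v v0 I I.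
  case: s ws ls => [_ /= ->|[e w] s /= /andP[evw _] _]; first by left.
  by right; exists e => //; exact: joins_ends evw.
rewrite finite_setU; split; first exact: finite_set1.
by apply: bigcup_finite => // e _; exact: finite_fset.
Qed.

(** For each vertex of [X] in turn, the vertices of a walk to it from [v0] are added one by one.
    Each new vertex is adjacent to one already present, so all remain joined to [v0] inside the
    growing set. *)
Lemma connected_hull (v0 : vertex L) X : connected_graph L ->
  exists Y, [/\ v0 \in Y, {subset X <= Y} & connected_induced Y].
Proof.
move=> Lconn.
suff H (t : seq (vertex L)) : exists Y, [/\ v0 \in Y, {subset t <= Y} &
    forall v, v \in Y -> path_within (induced_edges Y) v0 v].
  have [Y [v0Y XY Yc]] := H X; exists Y; split=> // u v uY vY.
  apply: (@path_within_trans _ _ v0); last exact: Yc.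
  by apply: path_within_sym; exact: Yc.
elim: t => [|x t [Y [v0Y tY Yc]]].
  exists [fset v0]%fset; split=> //; first by rewrite inE.
  by move=> v; rewrite inE => /eqP ->; exact: path_within_refl.
have [s [/and3P[ws _ /eqP ls] _]] := Lconn v0 x I I.
suff K u : u \in Y -> is_walk u s -> exists Y', [/\ {subset Y <= Y'},
    last u (unzip2 s) \in Y' &
    forall v, v \in Y' -> path_within (induced_edges Y') v0 v].
  have [Y' [YY' xY' Yc']] := K v0 v0Y ws.
  exists Y'; split=> //; first exact: YY'.
  move=> y; rewrite inE => /predU1P[->|/tY/YY'//].
  by rewrite -ls.
move=> {ls ws tY}; elim: s u Y v0Y Yc => [|[e w] s IH] u Y v0Y Yc uY /=.
  by move=> _; exists Y; split.
case/andP => euw ws.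
have YY1 : {subset Y <= (w |` Y)%fset}.
  by move=> y yY; rewrite inE yY orbT.
have [||||Y' [YY' lY' Yc']] := IH w (w |` Y)%fset => //.
- exact: YY1.
- move=> v; rewrite inE in_fset1 => /predU1P[->|vY]; last first.
    by apply: path_within_sub (Yc _ vY); exact: induced_edges_sub.
  apply: (@path_within_trans _ _ u).
    by apply: path_within_sub (Yc _ uY); exact: induced_edges_sub.
  apply: (path_within_edge euw).
  by apply: (induced_edges_joins euw (YY1 _ uY)); rewrite !inE eqxx.
- by rewrite !inE eqxx.
by exists Y'; split=> // y /YY1 /YY'.
Qed.

End Walks.

(** * Moves and histories of claiming games *)

Section Claiming.
Local Open Scope classical_set_scope.
Variable E : choiceType.
Implicit Types (F : set E) (A B C D : {fset E}) (h : history E).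

Lemma exhausting_extension k F C : [set` C] `<=` F -> #|` C| <= k ->
  exists D, [set` C] `<=` [set` D] /\ exhausting_rule k F D.
Proof.
move=> CF; move: {2}(k - #|` C|)%N (erefl (k - #|` C|)%N) => m.
elim: m C CF => [|m IH] C CF mE Ck.
  exists C; split=> //; split=> //; left.
  by apply/eqP; rewrite eqn_leq Ck -subn_eq0 mE.
have Ck' : #|` C| < k by rewrite -subn_gt0 mE.
have [FC|] := pselect (F `<=` [set` C]); first by exists C; do !split=> //; right.
move=> /existsNP[x /not_implyP[Fx /negP xC]].
have xCE : #|` (x |` C)%fset| = #|` C|.+1 by rewrite cardfsU1 xC.
have [|||D [CD DF]] := IH (x |` C)%fset; rewrite ?xCE ?subnS ?mE //.
  by move=> y; rewrite /= !inE => /predU1P[->|/CF].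
exists D; split=> // y yC; apply: CD.
by rewrite /= !inE; apply/orP; right.
Qed.

Definition fill k F C : {fset E} :=
  xget fset0 [set D | [set` C] `<=` [set` D] /\ exhausting_rule k F D].

Lemma fillP k F C : [set` C] `<=` F -> #|` C| <= k ->
  [set` C] `<=` [set` fill k F C] /\ exhausting_rule k F (fill k F C).
Proof.
move=> CF Ck.
exact: (xgetPex fset0 (exhausting_extension CF Ck)).
Qed.

Lemma exhausting_infinite k F A : infinite_set F -> exhausting_rule k F A ->
  exact_rule k F A.
Proof.
move=> Finf [AF [//|[_ FA]]]; case: Finf.
by apply: sub_finite_set FA _; exact: finite_fset.
Qed.

Lemma exhausting_card k F A : exhausting_rule k F A -> #|` A| <= k.
Proof. by case=> _ [-> //|[/ltnW]]. Qed.

Lemma maker_edges_nil : maker_edges [::] = set0 :> set E.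
Proof. by rewrite -subset0 => e. Qed.

Lemma maker_edges_rcons h A B :
  maker_edges (rcons h (A, B)) = maker_edges h `|` [set` A].
Proof.
rewrite /maker_edges predeqE => e /=; rewrite has_rcons /= orbC.
by split=> [/orP|[]] => [|->|->] //; rewrite orbT.
Qed.

Lemma breaker_edges_nil : breaker_edges [::] = set0 :> set E.
Proof. by rewrite -subset0 => e. Qed.

Lemma breaker_edges_rcons h A B :
  breaker_edges (rcons h (A, B)) = breaker_edges h `|` [set` B].
Proof.
rewrite /breaker_edges predeqE => e /=; rewrite has_rcons /= orbC.
by split=> [/orP|[]] => [|->|->] //; rewrite orbT.
Qed.

Lemma finite_maker_edges h : finite_set (maker_edges h).
Proof.
elim/last_ind: h => [|h [A B] IH]; first by rewrite maker_edges_nil; exact: finite_set0.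
by rewrite maker_edges_rcons finite_setU; split=> //; exact: finite_fset.
Qed.

Lemma finite_breaker_edges h : finite_set (breaker_edges h).
Proof.
elim/last_ind: h => [|h [A B] IH]; first by rewrite breaker_edges_nil; exact: finite_set0.
by rewrite breaker_edges_rcons finite_setU; split=> //; exact: finite_fset.
Qed.

Lemma infinite_unclaimed h (board : set E) : infinite_set board ->
  infinite_set (unclaimed board h).
Proof.
move=> Binf; apply: infinite_setD => //.
by rewrite finite_setU; split; [exact: finite_maker_edges|exact: finite_breaker_edges].
Qed.

Lemma claims_disjoint (board : set E) p q sigma h :
  legal_strategy (@exhausting_rule _) board p q sigma ->
  consistent (@exhausting_rule _) board q sigma h ->
  maker_edges h `&` breaker_edges h `<=` set0.
Proof.
move=> legal; elim=> [|{}h B ch IH [BF _]]; first by move=> e [].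
have [AF _] := legal h ch.
rewrite maker_edges_rcons breaker_edges_rcons => e [[me|Ae] [be|Be]].
- exact: (IH e).
- by have [[_ []]] := BF e Be; left.
- by have [_ []] := AF e Ae; right.
- by have [_ []] := BF e Be.
Qed.

Lemma maker_edges_board (board : set E) p q sigma h :
  legal_strategy (@exhausting_rule _) board p q sigma ->
  consistent (@exhausting_rule _) board q sigma h -> maker_edges h `<=` board.
Proof.
move=> legal; elim=> [|{}h B ch IH _]; first by rewrite maker_edges_nil.
rewrite maker_edges_rcons => e [/IH//|Ae].
by have [/(_ e Ae)[]] := legal h ch.
Qed.

(** Maker claims at least one edge per round as long as one is left, so the number of unclaimed
    edges drops; Breaker's replies are arbitrary legal moves. This makes the winning condition,
    stated for finished plays only, available at every position. *)
Lemma play_to_end (board : set E) p q sigma h : 0 < p -> finite_set board ->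
  legal_strategy (@exhausting_rule _) board p q sigma ->
  consistent (@exhausting_rule _) board q sigma h ->
  exists h', [/\ consistent (@exhausting_rule _) board q sigma h',
    unclaimed board h' = set0, maker_edges h `<=` maker_edges h' &
    breaker_edges h `<=` breaker_edges h'].
Proof.
move=> p_gt0 bfin legal.
have ufin g : finite_set (unclaimed board g) by exact: finite_setD.
move: {2}#|` _| (leqnn #|` fset_set (unclaimed board h)|) => n.
elim: n h => [|n IH] h hn ch.
  exists h; split=> //; apply: fset_set_set0 => //.
  by apply/eqP; rewrite -cardfs_eq0 -leqn0.
have [u0|/set0P[e ue]] := eqVneq (unclaimed board h) set0; first by exists h; split.
have [AF Arule] := legal h ch.
have [a aA] : exists a, a \in sigma h.
  case: Arule => [Ap|[_ /(_ e ue)]]; last by exists e.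
  by apply/fset0Pn; rewrite -cardfs_gt0 Ap.
have [||B [_ Bl]] := @exhausting_extension q
  (unclaimed board h `\` [set` sigma h]) fset0; first by move=> x; rewrite /= inE.
  by rewrite cardfs0.
have sub : unclaimed board (rcons h (sigma h, B)) `<=` unclaimed board h `\` [set a].
  move=> x [bx]; rewrite maker_edges_rcons breaker_edges_rcons => xN.
  split; first by split=> // -[mx|mx]; apply: xN; [left|right]; left.
  by move=> /= xa; apply: xN; left; right; rewrite /= xa.
have [|h' [ch' uh' mh' bh']] := IH _ _ (consistent_rcons ch Bl).
  rewrite -ltnS; apply: leq_trans hn; apply: fproper_ltn_card.
  rewrite fproperE; apply/andP; split.
    by apply/fsubsetP => x; rewrite !in_fset_set// !inE => /sub[].
  apply/negP => /fsubsetP/(_ a); rewrite !in_fset_set// !inE.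
  by move=> /(_ (AF a aA))/sub[_]; apply.
exists h'; split=> //.
  by apply: subset_trans mh'; rewrite maker_edges_rcons; exact: subsetUl.
by apply: subset_trans bh'; rewrite breaker_edges_rcons; exact: subsetUl.
Qed.

End Claiming.

(** * Compactness for choices of boundedly many elements *)

Section Compactness.
Local Open Scope classical_set_scope.
Variables V E : choiceType.
Implicit Types (X Y Z : {fset V}) (A B : {fset E}).

(* A is a largest set contained in chosen sets for arbitrarily large X;
   by maximality, no other element of F can recur. *)
Lemma recurrent_trace (P : {fset V} -> {fset E} -> Prop) p :
  (forall X, exists Y A, [/\ {subset X <= Y}, #|` A| <= p & P Y A]) ->
  exists A, #|` A| <= p /\ forall X (F : seq E), exists Y A',
    [/\ {subset X <= Y}, P Y A', {subset A <= A'} &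
        forall e, e \in F -> e \in A' -> e \in A].
Proof.
move=> HP.
pose rec A := forall X, exists Y A',
  [/\ {subset X <= Y}, #|` A'| <= p, P Y A' & {subset A <= A'}].
have rec0 : rec fset0.
  by move=> X; have [Y [A [XY Ap PA]]] := HP X; exists Y, A; split.
have recp A : rec A -> #|` A| <= p.
  move=> /(_ fset0)[Y [A' [_ A'p _ /fsubsetP AA']]].
  exact: leq_trans (fsubset_leq_card AA') A'p.
(* Starting from the empty set, elements are added as long as the set stays recurrent; this stops
   because recurrent sets have at most [p] elements. *)
have [A [recA Amax]] : exists A, rec A /\
    forall e, e \notin A -> ~ rec (e |` A)%fset.
  move: {2}(p - _)%N (leqnn (p - #|` fset0 : {fset E}|)%N) rec0.
  move: fset0 => A n; elim: n A => [|n IH] A pA recA.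
    exists A; split=> // e eA /recp; rewrite cardfsU1 eA add1n leqNgt.
    by rewrite ltnS -subn_eq0 -leqn0 pA.
  have [[e [eA recE]]|noE] := pselect (exists e, e \notin A /\ rec (e |` A)%fset).
    apply: IH recE; rewrite cardfsU1 eA add1n subnS.
    by move: pA; case: (p - _)%N.
  by exists A; split=> // e eA recE; apply: noE; exists e.
exists A; split=> [|X F]; first exact: recp.
(* By maximality, each [e] of [F] outside [A] has a [W] beyond which no chosen set contains both [A]
   and [e]; [Z] is the union of [X] and these finitely many [W]. *)
have [Z [XZ HZ]] : exists Z, {subset X <= Z} /\ forall e, e \in F -> e \notin A ->
    forall Y A', {subset Z <= Y} -> #|` A'| <= p -> P Y A' ->
    {subset A <= A'} -> e \notin A'.
  elim: F => [|e F [Z [XZ HZ]]]; first by exists X; split.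
  have [eA|eA] := boolP (e \in A).
    exists Z; split=> // f; rewrite inE => /predU1P[->|/HZ//]; by rewrite eA.
  have /existsNP[W HW] := Amax e eA.
  exists (Z `|` W)%fset; split=> [x /XZ xZ|f].
    by rewrite inE xZ.
  rewrite inE => /predU1P[->{f} _|fF fA] Y A' ZY A'p PA AA'; last first.
    by apply: (HZ f fF fA Y) => // x xZ; apply: ZY; rewrite inE xZ.
  apply/negP => eA'; apply: HW; exists Y, A'; split=> //.
    by move=> x xW; apply: ZY; rewrite inE xW orbT.
  by move=> f; rewrite !inE => /predU1P[->|/AA'].
have [Y [A' [ZY A'p PA AA']]] := recA Z.
exists Y, A'; split=> // [x /XZ /ZY //|e eF eA'].
apply: contraLR eA' => eA; exact: (HZ e eF eA Y).
Qed.

End Compactness.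

(** * Safe positions, their monotonicity and their uniform moves *)

Section SafePositions.
Local Open Scope classical_set_scope.
Variables (L : multigraph) (p q : nat) (v0 : vertex L).
Implicit Types (X Y : {fset vertex L}) (M B : set (edge L)).

(** One round of the game, [R] being the positions allowed after it. [safe] is the greatest fixed
    point of this operator, expressed through an invariant [R]. *)
Definition can_maintain X (R : set (edge L) -> set (edge L) -> Prop) M B : Prop :=
  exists A : {fset edge L}, [/\
    exists2 x, boundary X x & path_within (~` B) v0 x,
    #|` A| <= p, [set` A] `<=` induced_edges X `\` B &
    forall A' : {fset edge L}, #|` A'| <= q ->
      [set` A'] `&` (M `|` [set` A]) `<=` set0 ->
      R (M `|` [set` A]) (B `|` [set` A'])].

(* Maker, to move, can forever keep v0 connected to the boundary of X outside
   Breaker's edges, M and B being the edges claimed so far.  Breaker is only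
   barred from Maker's edges and may play fewer than q of them, which makes
   safety monotone in all its arguments. *)
Definition safe X M B : Prop :=
  exists2 R, (forall M B, R M B -> can_maintain X R M B) & R M B.

Lemma safe_maintain X M B : safe X M B -> can_maintain X (safe X) M B.
Proof.
move=> [R Rstep /Rstep[A [bx Ap AX reply]]]; exists A; split=> // A' A'q A'M.
by exists R => //; exact: reply.
Qed.

(** A boundary vertex of [Y] is either outside [X] or on the boundary of [X], since its neighbour
    outside [Y] is also outside [X]. Hence [exit_path] applies. *)
Lemma boundary_path_sub X Y B B' : v0 \in X -> {subset X <= Y} ->
  induced_edges X `&` B' `<=` B ->
  (exists2 x, boundary Y x & path_within (~` B) v0 x) ->
  exists2 x, boundary X x & path_within (~` B') v0 x.
Proof.
move=> v0X XY BB' [x [_ [e [y [yY exy]]]] vx].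
have [|x' bx' vx'] := exit_path v0X vx.
  have [xX|xX] := boolP (x \in X); [left|by right].
  by split=> //; exists e, y; split=> //; apply: contraNN yY; exact: XY.
exists x' => //; apply: path_within_sub vx' => f [fX fB] fB'.
by apply: fB; apply: BB'.
Qed.

(** Maker plays the trace on [X] of her move for [Y]. Breaker's reply is also cut down to [X] before
    being used in [Y], since outside [X] it might meet edges that Maker owns only there. *)
Lemma safe_sub X Y M M' B B' : v0 \in X -> {subset X <= Y} ->
  induced_edges X `&` M `<=` M' -> induced_edges X `&` B' `<=` B ->
  safe Y M B -> safe X M' B'.
Proof.
move=> v0X XY MM' BB' safeY.
exists (fun M' B' => exists M B, [/\ induced_edges X `&` M `<=` M',
  induced_edges X `&` B' `<=` B & safe Y M B]); last by exists M, B.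
move=> {M M' B B' MM' BB' safeY} M' B' [M [B [MM' BB' /safe_maintain]]].
pose EX := fset_set (induced_edges X).
have EXP e : (e \in EX) <-> induced_edges X e.
  by rewrite in_fset_set ?inE//; exact: finite_induced_edges.
case=> A [bx Ap AE reply]; exists (A `&` EX)%fset; split.
- exact: boundary_path_sub bx.
- exact: leq_trans (fsubset_leq_card (fsubsetIl _ _)) Ap.
- move=> e; rewrite /= inE => /andP[/AE[_ eB] /EXP eX]; split=> // eB'.
  by apply: eB; exact: BB'.
move=> A' A'q A'M.
exists (M `|` [set` A]), (B `|` [set` (A' `&` EX)%fset]); split.
- move=> e [eX [eM|eA]]; first by left; apply: MM'.
  by right; rewrite /= inE; apply/andP; split=> //; apply/EXP.
- move=> e [eX [eB|eA]]; first by left; apply: BB'.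
  by right; rewrite /= inE; apply/andP; split=> //; apply/EXP.
apply: reply; first exact: leq_trans (fsubset_leq_card (fsubsetIl _ _)) A'q.
move=> e [/=]; rewrite inE => /andP[eA' /EXP eX] [eM|eA].
  by apply: (A'M e); split=> //; left; apply: MM'.
apply: (A'M e); split=> //; right; rewrite /= inE.
by apply/andP; split=> //; apply/EXP.
Qed.

(** The invariant compares the position with a history consistent with [sigma]. Running that play to
    its end yields a path of Maker's edges, which Breaker cannot own at the present position
    either. *)
Lemma escape_safe X : 0 < p -> maker_wins_escape p q X v0 -> safe X set0 set0.
Proof.
move=> p_gt0 [sigma [legal win]].
exists (fun M B => exists h,
  [/\ consistent (@exhausting_rule _) (induced_edges X) q sigma h,
      maker_edges h `<=` M & induced_edges X `&` B `<=` breaker_edges h]);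
  last first.
  exists [::]; split; [exact: consistent_nil| |by move=> e []].
  by rewrite maker_edges_nil => e.
move=> M B [h [ch hM hB]].
have [AF _] := legal h ch.
exists (sigma h); split.
- have [h' [ch' uh' mh' bh']] :=
    play_to_end p_gt0 (finite_induced_edges X) legal ch.
  have [x bx vx] := win h' ch' uh'; exists x => //.
  apply: path_within_sub vx => e em eB.
  have eX : induced_edges X e by exact: (maker_edges_board legal ch').
  by apply: (claims_disjoint legal ch' (t := e)); split; last exact/bh'/hB.
- exact: exhausting_card (legal h ch).
- by move=> e /AF [eX eh]; split=> // eB; apply: eh; right; exact: hB.
move=> A' A'q A'M.
(* The reply [A'] need not be legal in the escape game: it may be too small, leave [X], or repeat
   claimed edges. Its fresh edges are kept and extended to a legal move, which only helps
   Breaker. *)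
pose C := [fset e in A' | e \in unclaimed (induced_edges X) h]%fset.
have [||D [CD DF]] := @exhausting_extension _ q
  (unclaimed (induced_edges X) h `\` [set` sigma h]) C.
- move=> e; rewrite /= !inE => /andP[eA' eu]; split; first exact/set_mem.
  by move=> eA; apply: (A'M e); split=> //; right.
- by apply: leq_trans A'q; apply: fsubset_leq_card; exact: fset_sub.
exists (rcons h (sigma h, D)); split; first exact: consistent_rcons.
- by rewrite maker_edges_rcons; exact: setSU.
rewrite breaker_edges_rcons => e [eX [eB|eA']]; first by left; exact: hB.
have [bh|bh] := pselect (breaker_edges h e); [by left|right].
apply: CD; rewrite /= !inE; apply/andP; split=> //; apply/mem_set.
split=> // -[mh|//]; apply: (A'M e); split=> //; left; exact: hM.
Qed.

(* Larger boards are harder for Maker, so the trace on X of her moves on larger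
   boards Y is good on X; a recurrent trace is good on all X at once. *)
Lemma uniform_move M B : (forall X, v0 \in X -> safe X M B) ->
  exists A : {fset edge L}, [/\ #|` A| <= p, [set` A] `<=` ~` B &
    forall (A' : {fset edge L}) X, v0 \in X -> #|` A'| <= q ->
      [set` A'] `&` (M `|` [set` A]) `<=` set0 ->
      safe X (M `|` [set` A]) (B `|` [set` A'])].
Proof.
move=> safeMB.
have [X|A [Ap recA]] := @recurrent_trace _ _ (fun Y (A : {fset edge L}) =>
  [set` A] `<=` ~` B /\ forall A' : {fset edge L}, #|` A'| <= q ->
      [set` A'] `&` (M `|` [set` A]) `<=` set0 ->
      safe Y (M `|` [set` A]) (B `|` [set` A'])) p.
  have [|A [_ Ap AX reply]] := safe_maintain (safeMB (v0 |` X)%fset _).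
    by rewrite !inE eqxx.
  exists (v0 |` X)%fset, A; split=> //; first by move=> x xX; rewrite inE xX orbT.
  by split=> // e /AX[].
exists A; split=> //.
  have [Y [A' [_ [A'B _] AA' _]]] := recA fset0 [::].
  by move=> e /AA' /A'B.
move=> A' X v0X A'q A'M.
pose EX := fset_set (induced_edges X).
have EXP e : (e \in EX) <-> induced_edges X e.
  by rewrite in_fset_set ?inE//; exact: finite_induced_edges.
(* [A1] is good for [Y] and agrees with [A] on the edges of [X], so safety of [Y] after [A1]
   descends to safety of [X] after [A]. The reply is cut down to [X] because [A1] may have further
   edges outside. *)
have [Y [A1 [XY [_ reply] AA1 A1A]]] := recA X EX.
have : safe Y (M `|` [set` A1]) (B `|` [set` (A' `&` EX)%fset]).
  apply: reply; first exact: leq_trans (fsubset_leq_card (fsubsetIl _ _)) A'q.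
  move=> e [/=]; rewrite inE => /andP[eA' eX] eMA; apply: (A'M e); split=> //.
  by case: eMA => [|/(A1A e eX)]; [left|right].
apply: safe_sub => // e [eX [eMB|eA]]; [by left| |by left|].
  by right; apply: A1A eA; apply/EXP.
by right; rewrite /= inE; apply/andP; split=> //; apply/EXP.
Qed.

Lemma safe_infinite_component B : finite_set B ->
  (forall X, v0 \in X -> exists M, safe X M B) ->
  infinite_set (component (~` B) v0).
Proof.
move=> Bfin safeB Cfin.
pose X := fset_set (component (~` B) v0 `|`
  \bigcup_(e in B) [set` [fset (ends e).1; (ends e).2]%fset]).
have XP x : (x \in X) <-> (component (~` B) v0 `|`
    \bigcup_(e in B) [set` [fset (ends e).1; (ends e).2]%fset]) x.
  rewrite in_fset_set ?inE// finite_setU; split=> //.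
  by apply: bigcup_finite => // e _; exact: finite_fset.
have v0X : v0 \in X by apply/XP; left; exact: path_within_refl.
have [M /safe_maintain[A [[x [xX [e [y [yX exy]]]] vx] _ _ _]]] := safeB X v0X.
move/negP: yX; apply; apply/XP.
(* The edge [e] leaves [X] at [y]. If it is Breaker's, its ends were put into [X]; otherwise [y]
   lies in the component, which is also in [X]. *)
have [eB|eB] := pselect (B e).
  by right; exists e => //; rewrite /= (@joins_ends _ e y x)// joinsC.
by left; apply: path_within_trans vx _; exact: path_within_edge exy _.
Qed.

End SafePositions.

(** * Transfer of winning strategies between the two games *)

Section Transfer.
Local Open Scope classical_set_scope.
Variables (L : multigraph) (v0 : vertex L) (p q : nat).
Hypotheses (L_infinite : infinite_graph L) (L_connected : connected_graph L).

Let Einf : infinite_set [set: edge L].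
Proof. exact: infinite_edges. Qed.

Lemma percolation_of_escape : 0 < p ->
  (forall X, v0 \in X -> connected_induced X -> maker_wins_escape p q X v0) ->
  maker_wins_percolation p q v0.
Proof.
move=> p_gt0 escape.
pose safe_all M B := forall X, v0 \in X -> safe p q v0 X M B.
pose good h (A : {fset edge L}) := exact_rule p (unclaimed setT h) A /\
  forall B, exact_rule q (unclaimed setT h `\` [set` A]) B ->
    safe_all (maker_edges h `|` [set` A]) (breaker_edges h `|` [set` B]).
have goodP h : safe_all (maker_edges h) (breaker_edges h) -> exists A, good h A.
  move=> /uniform_move[A [Ap AB reply]].
  (* The uniform move may repeat safe edges or have fewer than [p]. Its fresh edges are topped up to
     exactly [p], as infinitely many edges are unclaimed. *)
  pose C := [fset e in A | e \in unclaimed setT h]%fset.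
  have [||D [CD DF]] := @exhausting_extension _ p (unclaimed setT h) C.
  - by move=> e; rewrite /= !inE => /andP[_ /set_mem].
  - by apply: leq_trans Ap; apply: fsubset_leq_card; exact: fset_sub.
  have AD : [set` A] `<=` maker_edges h `|` [set` D].
    move=> e eA; have [mh|mh] := pselect (maker_edges h e); [by left|right].
    apply: CD; rewrite /= !inE; apply/andP; split=> //; apply/mem_set.
    by split=> // -[//|]; exact: AB.
  exists D; split; first by apply: exhausting_infinite DF; exact: infinite_unclaimed.
  move=> B [BF Bq] X v0X.
  apply: (@safe_sub _ _ _ _ X X (maker_edges h `|` [set` A]) _
    (breaker_edges h `|` [set` B])) => //.
    by move=> e [_ [|/AD]]; [left|].
  apply: reply; rewrite ?Bq// => e [/BF[[_ eh] eD]] [mh|/AD[mh|//]].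
  - by apply: eh; left.
  - by apply: eh; left.
pose sigma h := xget fset0 [set A | good h A].
have safe_h h : consistent (@exact_rule _) setT q sigma h ->
    safe_all (maker_edges h) (breaker_edges h).
  elim=> [|{}h B ch IH BF].
    rewrite maker_edges_nil breaker_edges_nil => X v0X.
    (* The escape games are assumed won only on connected graphs, whereas [X] is arbitrary; safety
       descends from a connected [Y] containing it. *)
    have [Y [v0Y XY Yc]] := connected_hull v0 X L_connected.
    apply: (safe_sub v0X XY _ _ (escape_safe p_gt0 (escape Y v0Y Yc))).
    - by move=> e [].
    - by move=> e [].
  rewrite maker_edges_rcons breaker_edges_rcons.
  by have [_] : good h (sigma h) := xgetPex fset0 (goodP h IH); apply.
exists sigma; split=> h ch.
  by have [] : good h (sigma h) := xgetPex fset0 (goodP h (safe_h h ch)).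
apply: (@safe_infinite_component _ p q); first exact: finite_breaker_edges.
by move=> X v0X; exists (maker_edges h); exact: safe_h.
Qed.

(** * Simulating a percolation play alongside the escape game *)

Section Simulation.
Variables (X : {fset vertex L}) (sigma : strategy (edge L)).
Local Notation board := (induced_edges X).

(* A percolation play following sigma, in which Breaker copies his moves in the
   escape game, topped up to q edges outside X. *)
Definition simulate : history (edge L) -> history (edge L) :=
  foldl (fun g r => rcons g (sigma g, fill q
    ((unclaimed setT g `\` [set` sigma g]) `&` (~` board `|` [set` r.2])) r.2))
  [::].

(** The percolation move may use edges outside [X] or edges Maker already owns from an earlier
    top-up, hence the restriction and the new top-up. *)
Definition simulation_strategy (h : history (edge L)) : {fset edge L} :=
  fill p (unclaimed board h)
    [fset e in sigma (simulate h) | e \in unclaimed board h]%fset.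

Hypothesis sigma_legal : legal_strategy (@exact_rule _) setT p q sigma.

Lemma simulation_strategyP h :
  consistent (@exact_rule _) setT q sigma (simulate h) ->
  exhausting_rule p (unclaimed board h) (simulation_strategy h) /\
  [set` sigma (simulate h)] `&` unclaimed board h
    `<=` [set` simulation_strategy h].
Proof.
move=> /sigma_legal[_ Ap].
have [||CD DF] := @fillP _ p (unclaimed board h)
  [fset e in sigma (simulate h) | e \in unclaimed board h]%fset.
- by move=> e; rewrite /= !inE => /andP[_ /set_mem].
- by rewrite -Ap; apply: fsubset_leq_card; exact: fset_sub.
split=> // e [es eu]; apply: CD; rewrite /= !inE; apply/andP; split=> //.
exact/mem_set.
Qed.

(** On [X] Breaker owns the same edges in both plays, while Maker may own more in the escape game.
    Thus Breaker's escape moves are available in the simulation, and a simulated Maker edge in [X]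
    is hers or still free in the escape game. *)
Lemma simulateP h :
  consistent (@exhausting_rule _) board q simulation_strategy h ->
  [/\ consistent (@exact_rule _) setT q sigma (simulate h),
      board `&` maker_edges (simulate h) `<=` maker_edges h,
      board `&` breaker_edges (simulate h) `<=` breaker_edges h &
      breaker_edges h `<=` breaker_edges (simulate h)].
Proof.
elim=> [|{}h B ch [cg mg bg gb] Bl].
  by split; rewrite ?maker_edges_nil ?breaker_edges_nil; [exact: consistent_nil
    |move=> e []|move=> e []|].
have [_ sub] := simulation_strategyP cg.
have [sF _] := sigma_legal cg.
rewrite /simulate foldl_rcons -/(simulate h) /=.
set F := _ `&` _.
have BF : [set` B] `<=` F.
  move=> e eB; have [/(_ e eB)[[eX eh] es] _] := Bl.
  split; last by right.
  split; first split=> // -[mh|bh].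
  - by apply: eh; left; exact: mg.
  - by apply: eh; right; exact: bg.
  by move=> eA; apply: es; exact: sub.
(* Infinitely many free edges lie outside [X], so Breaker's copied move can be completed to exactly
   [q] edges without touching [X] further. *)
have Finf : infinite_set F.
  apply: (@sub_infinite_set _ (unclaimed setT (simulate h) `\`
    ([set` sigma (simulate h)] `|` board))).
    by move=> e [eu eN]; split; [split=> // es|left=> eX]; apply: eN; [left|right].
  apply: infinite_setD; first exact: infinite_unclaimed.
  by rewrite finite_setU; split; [exact: finite_fset|exact: finite_induced_edges].
have [BD /(exhausting_infinite Finf)[DF Dq]] := fillP BF (exhausting_card Bl).
rewrite !maker_edges_rcons !breaker_edges_rcons; split.
- by apply: consistent_rcons => //; split=> // e /DF[].
- move=> e [eX [mh|es]]; first by left; exact: mg.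
  have [mh|mh] := pselect (maker_edges h e); [by left|right; apply: sub].
  have [_ eg] := sF e es; split=> //; split=> // -[//|bh].
  by apply: eg; right; exact: gb.
- move=> e [eX [bh|/DF[_ [//|]]]]; [by left; exact: bg|by right].
- by move=> e [/gb|/BD]; [left|right].
Qed.

End Simulation.

Lemma escape_of_percolation (X : {fset vertex L}) : v0 \in X ->
  maker_wins_percolation p q v0 -> maker_wins_escape p q X v0.
Proof.
move=> v0X [sigma [legal win]].
exists (simulation_strategy X sigma); split=> h /(simulateP legal)[cg _ _ gb].
  by have [] := simulation_strategyP legal cg.
move=> u0.
have [x vx xX] : exists2 x, component (~` breaker_edges (simulate X sigma h)) v0 x
    & x \notin X.
  apply: contrapT => noexit; apply: (win _ cg).
  apply: (@sub_finite_set _ _ [set` X]); last exact: finite_fset.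
  by move=> x vx; apply/negPn/negP => xX; apply: noexit; exists x.
have [|x' bx' vx'] := exit_path v0X vx; first by right.
exists x' => //; apply: path_within_sub vx' => e [eX eg].
apply: contrapT => em; suff : unclaimed (induced_edges X) h e by rewrite u0.
by split=> // -[//|/gb].
Qed.

End Transfer.

Theorem theorem2p2 (L : multigraph) (v0 : vertex L) (p q : nat)
  (L_infinite : infinite_graph L) (L_connected : connected_graph L)
  (p_gt0 : 0 < p) (q_gt0 : 0 < q) :
  maker_wins_percolation p q v0 <->
  forall X : {fset vertex L}, v0 \in X -> connected_induced X ->
    maker_wins_escape p q X v0.
Proof.
split=> [win X v0X _|]; first exact: escape_of_percolation.
exact: percolation_of_escape.
Qed.
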